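(* For all integers $m,n\ge 0$, each of the recursively defined polynomials $\alpha^{(m,n)},\beta^{(m,n)},c^{(m,n)}_0,\ldots,c^{(m,n)}_{m+n}\in S^{(m,n)}$ given in the context has degree at most $\binom{m+n}{m}$ in each of the four variable sets $\mathbf{a}=\{a_0,\ldots,a_m\}$, $\mathbf{b}=\{b_0,\ldots,b_n\}$, $\mathbf{A}=\{A_0,\ldots,A_m\}$, $\mathbf{B}=\{B_0,\ldots,B_n\}$.
   Context: For integers $m,n\ge 0$ let $S^{(m,n)}=\mathbb{Z}[a_0,\ldots,a_m,b_0,\ldots,b_n,A_0,\ldots,A_m,B_0,\ldots,B_n]$, a polynomial ring over $\mathbb{Z}$; for $m'\le m$, $n'\le n$ regard $S^{(m',n')}$ as a subring of $S^{(m,n)}$ in the obvious way. The degree of a polynomial in one of the variable sets means its total degree in the variables of that set, the variables in the other three sets being treated as having degree $0$. The polynomials $\alpha^{(m,n)},\beta^{(m,n)},c^{(m,n)}_k$ ($0\le k\le m+n$) are defined recursively as follows. Initial conditions. For $m=0$ and $n\ge 0$: $\alpha^{(0,n)}=1$, $\beta^{(0,n)}=a_0A_0$, $c^{(0,n)}_k=a_0b_k$ for $0\le k\le n$. For $n=0$ and $m\ge 1$: $\alpha^{(m,0)}=b_0B_0$, $\beta^{(m,0)}=1$, $c^{(m,0)}_k=a_kb_0$ for $0\le k\le m$. (When $m=n=0$ the first set of formulas is used.) Recursion. For $m,n\ge 1$, define auxiliary polynomials (depending on $(m,n)$) $$d=b_n\beta^{(m,n-1)}-\sum_{k=n}^{m+n-1}c^{(m,n-1)}_kA_{k-n},\qquad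 e=a_m\alpha^{(m-1,n)}-\sum_{k=m}^{m+n-1}c^{(m-1,n)}_kB_{k-m},$$ and set $$\alpha^{(m,n)}=\alpha^{(m,n-1)}+B_n\,d\,\alpha^{(m-1,n)},\qquad \beta^{(m,n)}=\beta^{(m,n-1)}+B_n\,d\,\beta^{(m-1,n)},$$ $$c^{(m,n)}_k=c^{(m,n-1)}_k+B_n\,d\,c^{(m-1,n)}_k\quad(0\le k\le m+n-1),\qquad c^{(m,n)}_{m+n}=d\,e.$$ *)

(* Defs.v *)
From HB Require Import structures.
From mathcomp Require Import all_boot all_order all_algebra finmap monalg.

Set Implicit Arguments.
Unset Strict Implicit.
Unset Printing Implicit Defensive.

Import GRing.Theory.

(* All rings S^(m,n) are subrings of one polynomial ring over Z, whose
   variables are the four infinite families below; S^(m,n) is then cut out by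
   the predicate [in_S m n]. *)
Variant var := Va of nat | Vb of nat | VA of nat | VB of nat.

Definition var_code (v : var) : nat * nat :=
  match v with
  | Va i => (0, i) | Vb i => (1, i) | VA i => (2, i) | VB i => (3, i)
  end.

Definition var_decode (x : nat * nat) : var :=
  match x with
  | (0, i) => Va i | (1, i) => Vb i | (2, i) => VA i | (_, i) => VB i
  end.

Lemma var_codeK : cancel var_code var_decode.
Proof. by case. Qed.

HB.instance Definition _ := Choice.copy var (can_type var_codeK).

Definition poly_ring : comNzRingType := {malg int[{cmonom var}]}.

Local Open Scope ring_scope.

Definition X (v : var) : poly_ring := << ucm v >>.
Definition a (i : nat) : poly_ring := X (Va i).
Definition b (i : nat) : poly_ring := X (Vb i).
Definition A (i : nat) : poly_ring := X (VA i).
Definition B (i : nat) : poly_ring := X (VB i).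

Definition set_a (m : nat) : pred var :=
  fun v => if v is Va i then (i <= m)%N else false.
Definition set_b (n : nat) : pred var :=
  fun v => if v is Vb i then (i <= n)%N else false.
Definition set_A (m : nat) : pred var :=
  fun v => if v is VA i then (i <= m)%N else false.
Definition set_B (n : nat) : pred var :=
  fun v => if v is VB i then (i <= n)%N else false.

Definition vars (m n : nat) : pred var :=
  fun v => [|| set_a m v, set_b n v, set_A m v | set_B n v].

Definition in_S (m n : nat) (p : poly_ring) : Prop :=
  forall (u : {cmonom var}) (v : var),
    u \in msupp p -> u v != 0%N -> vars m n v.

(* Total degree in the variables satisfying V; the zero polynomial gets 0. *)
Definition degree_in (V : pred var) (p : poly_ring) : nat :=
  (\max_(u <- msupp p) \sum_(v <- finsupp u | V v) u v)%N.

(* The polynomials attached to a pair (m,n); for the pair (m,n), [c k] is only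
   meaningful for k <= m + n, and is set to 0 beyond. *)
Record family := Family {
  f_alpha : poly_ring;
  f_beta : poly_ring;
  f_c : nat -> poly_ring
}.

Definition init0n (n : nat) : family :=
  Family 1 (a 0%N * A 0%N) (fun k => if (k <= n)%N then a 0%N * b k else 0).

Definition initm0 (m : nat) : family :=
  Family (b 0%N * B 0%N) 1 (fun k => if (k <= m)%N then a k * b 0%N else 0).

(* F plays the role of the family at (m,n-1), G of the family at (m-1,n). *)
Definition aux_d (m n : nat) (F : family) : poly_ring :=
  b n * f_beta F - \sum_(n <= k < m + n) f_c F k * A (k - n)%N.

Definition aux_e (m n : nat) (G : family) : poly_ring :=
  a m * f_alpha G - \sum_(m <= k < m + n) f_c G k * B (k - m)%N.

Definition step (m n : nat) (F G : family) : family :=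
  let d := aux_d m n F in
  let e := aux_e m n G in
  Family (f_alpha F + B n * d * f_alpha G)
         (f_beta F + B n * d * f_beta G)
         (fun k => if (k < m + n)%N then f_c F k + B n * d * f_c G k
                   else if k == (m + n)%N then d * e else 0).

Fixpoint fam (m : nat) : nat -> family :=
  match m with
  | 0 => init0n
  | m'.+1 =>
      fix fam_m (n : nat) : family :=
        match n with
        | 0 => initm0 m'.+1
        | n'.+1 => step m'.+1 n'.+1 (fam_m n') (fam m' n'.+1)
        end
  end.

Lemma fam0n (n : nat) : fam 0 n = init0n n.
Proof. by []. Qed.

Lemma famS0 (m : nat) : fam m.+1 0 = initm0 m.+1.
Proof. by []. Qed.

Lemma famSS (m n : nat) :
  fam m.+1 n.+1 = step m.+1 n.+1 (fam m.+1 n) (fam m n.+1).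
Proof. by []. Qed.

Definition alpha (m n : nat) : poly_ring := f_alpha (fam m n).
Definition beta (m n : nat) : poly_ring := f_beta (fam m n).
Definition c (m n k : nat) : poly_ring := f_c (fam m n) k.

(* Main.v *)
Require Import Defs.
From mathcomp Require Import all_boot all_order all_algebra finmap monalg.
From mathcomp Require Import zify.

Set Implicit Arguments.
Unset Strict Implicit.
Unset Printing Implicit Defensive.

Import GRing.Theory.

Local Open Scope fset_scope.
Local Open Scope ring_scope.

(** The bound N = 'C(m + n, m) is not inductive by itself, because [aux_d] and
    [aux_e] multiply the earlier polynomials by one more variable.  It becomes
    inductive once it is sharpened by one in two variable sets for each kind of
    polynomial.  The degrees in (a, b, A, B) are at most
      - (N-1, N, N-1, N) for alpha,
      - (N, N-1, N, N-1) for beta,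
      - (N, N, N-1, N-1) for the c_k.
    Write N' = 'C(m + n - 1, m) and N'' = 'C(m + n - 1, m - 1), so that
    N = N' + N'' by Pascal's rule.  Then d has degrees at most
    (N', N', N', N'-1) and e has degrees at most (N'', N'', N''-1, N''), and
    every product in the recursion meets the sharpened bound for N.

    The four degrees are handled by one induction, [degree_in_fam].  It bounds
    the degree in an arbitrary set V of variables, the numbers wa, wb, wA, wB
    being upper bounds for the indicator of V on the four families of
    generators of S^(m,n).  Taking one of them to be 1 and the others 0 gives
    the four degree bounds; taking V to be the set of the variables that do not
    belong to S^(m,n), and all four numbers 0, gives membership in S^(m,n). *)

(** * Degree in a set of variables *)

Section DegreeIn.
Variable V : pred var.
Implicit Types (u : {cmonom var}) (p q : poly_ring) (N : nat).

(** Total degree of a monomial in the variables satisfying V. *)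
Definition mdeg_in (u : {cmonom var}) : nat :=
  (\sum_(v <- finsupp u | V v) u v)%N.

Lemma mdeg_inEw u (D : {fset var}) : finsupp u `<=` D ->
  mdeg_in u = (\sum_(v <- D | V v) u v)%N.
Proof.
move=> uD; rewrite /mdeg_in [LHS]big_mkcond [RHS]big_mkcond /=.
rewrite (big_fset_incl _ uD) //= => v _.
by rewrite -cmE_eq0 => /eqP->; rewrite if_same.
Qed.

Lemma mdeg_in1 : mdeg_in (mone : {cmonom var}) = 0%N.
Proof. by rewrite /mdeg_in mdom1 big_mkcond big_seq_fset0. Qed.

Lemma mdeg_inU v : mdeg_in (ucm v) = V v.
Proof.
rewrite /mdeg_in mdomU big_mkcond big_seq_fset1 cmUU.
by case: (V v).
Qed.

Lemma mdeg_inM u1 u2 : mdeg_in (mmul u1 u2) = (mdeg_in u1 + mdeg_in u2)%N.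
Proof.
rewrite (mdeg_inEw (fsubsetUl (finsupp u1) (finsupp u2))).
rewrite (mdeg_inEw (fsubsetUr (finsupp u1) (finsupp u2))).
by rewrite /mdeg_in mdomD -big_split /=; apply: eq_bigr => v _; rewrite cmM.
Qed.

Lemma degree_in_leP p N :
  reflect (forall u, u \in msupp p -> (mdeg_in u <= N)%N)
          (degree_in V p <= N)%N.
Proof.
by apply: (iffP (bigmax_leqP_seq _ _ _ _)) => h u /h; auto.
Qed.

Lemma degree_in_leW p N1 N2 :
  (degree_in V p <= N1 -> N1 <= N2 -> degree_in V p <= N2)%N.
Proof. exact: leq_trans. Qed.

Lemma degree_in0 N : (degree_in V 0 <= N)%N.
Proof. by apply/degree_in_leP => u; rewrite msupp0 in_fset0. Qed.

Lemma degree_in1 N : (degree_in V 1 <= N)%N.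
Proof.
apply/degree_in_leP => u; rewrite (msuppU1 int (mone : {cmonom var})) in_fset1 => /eqP->.
by rewrite mdeg_in1.
Qed.

Lemma degree_inX v N : (V v <= N)%N -> (degree_in V (X v) <= N)%N.
Proof.
move=> VvN; apply/degree_in_leP => u.
by rewrite (msuppU1 int (ucm v)) in_fset1 => /eqP->; rewrite mdeg_inU.
Qed.

Lemma degree_inN p N :
  (degree_in V p <= N)%N -> (degree_in V (- p) <= N)%N.
Proof. by rewrite /degree_in msuppN. Qed.

Lemma degree_inD p q N : (degree_in V p <= N)%N ->
  (degree_in V q <= N)%N -> (degree_in V (p + q) <= N)%N.
Proof.
move=> /degree_in_leP hp /degree_in_leP hq; apply/degree_in_leP => u.
by move=> /(fsubsetP (msuppD_le _ _)); rewrite in_fsetU => /orP[/hp|/hq].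
Qed.

Lemma degree_inM p q N1 N2 : (degree_in V p <= N1)%N ->
  (degree_in V q <= N2)%N -> (degree_in V (p * q) <= N1 + N2)%N.
Proof.
move=> /degree_in_leP hp /degree_in_leP hq; apply/degree_in_leP => u.
move=> /msuppM_le [u1 [u2 [/hp h1 /hq h2 ->]]].
by rewrite mdeg_inM leq_add.
Qed.

Lemma degree_in_sum (r : seq nat) (P : pred nat) (F : nat -> poly_ring) N :
  (forall i, P i -> (degree_in V (F i) <= N)%N) ->
  (degree_in V (\sum_(i <- r | P i) F i) <= N)%N.
Proof.
move=> h; elim/big_ind: _ => //; first exact: degree_in0.
by move=> p q; apply: degree_inD.
Qed.

End DegreeIn.

(** * The sharpened bounds *)

(** The numbers wa, wb, wA, wB bound the indicator of V on the generators of
    S^(m,n) of each kind. *)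
Definition gen_bound (V : pred var) (wa wb wA wB m n : nat) : Prop :=
  [/\ forall i, (i <= m)%N -> (V (Va i) <= wa)%N,
      forall i, (i <= n)%N -> (V (Vb i) <= wb)%N,
      forall i, (i <= m)%N -> (V (VA i) <= wA)%N
    & forall i, (i <= n)%N -> (V (VB i) <= wB)%N].

(** The inductive invariant, with N standing for the positive number
    'C(m + n, m): the bound N drops to N - 1 in a and A for alpha, in b and B
    for beta, and in A and B for every c_k. *)
Definition fam_bound (V : pred var) (wa wb wA wB N : nat) (F : Defs.family) : Prop :=
  [/\ (degree_in V (f_alpha F) <= N.-1 * (wa + wA) + N * (wb + wB))%N,
      (degree_in V (f_beta F) <= N * (wa + wA) + N.-1 * (wb + wB))%N
    & forall k, (degree_in V (f_c F k) <= N * (wa + wb) + N.-1 * (wA + wB))%N].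

Lemma gen_boundW V wa wb wA wB m n m' n' : (m' <= m)%N -> (n' <= n)%N ->
  gen_bound V wa wb wA wB m n -> gen_bound V wa wb wA wB m' n'.
Proof.
move=> mm nn [ha hb hA hB].
by split=> i le_i; [apply: ha|apply: hb|apply: hA|apply: hB];
   apply: leq_trans le_i _.
Qed.

Section Bounds.
Variables (V : pred var) (wa wb wA wB : nat).

Lemma degree_in_init0n n : gen_bound V wa wb wA wB 0 n ->
  fam_bound V wa wb wA wB 1 (init0n n).
Proof.
move=> [ha hb hA hB]; split=> [||k] /=; rewrite ?mul0n ?mul1n ?addn0 ?add0n.
- exact: degree_in1.
- by apply: degree_inM; apply: degree_inX; [apply: ha|apply: hA].
- case: ifP => [kn|_]; last exact: degree_in0.
  by apply: degree_inM; apply: degree_inX; [apply: ha|apply: hb].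
Qed.

Lemma degree_in_initm0 m : gen_bound V wa wb wA wB m 0 ->
  fam_bound V wa wb wA wB 1 (initm0 m).
Proof.
move=> [ha hb hA hB]; split=> [||k] /=; rewrite ?mul0n ?mul1n ?addn0 ?add0n.
- by apply: degree_inM; apply: degree_inX; [apply: hb|apply: hB].
- exact: degree_in1.
- case: ifP => [km|_]; last exact: degree_in0.
  by apply: degree_inM; apply: degree_inX; [apply: ha|apply: hb].
Qed.

Lemma degree_in_aux_d m n N F : (0 < N)%N ->
  gen_bound V wa wb wA wB m n -> fam_bound V wa wb wA wB N F ->
  (degree_in V (aux_d m n F) <= N * (wa + wb + wA) + N.-1 * wB)%N.
Proof.
case: N => // N _ [ha hb hA hB] [_ hbeta hc].
apply: degree_inD.
  apply: degree_in_leW (degree_inM (degree_inX (hb n (leqnn n))) hbeta) _.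
  by rewrite /=; lia.
rewrite big_nat_cond; apply: degree_inN; apply: degree_in_sum => k.
rewrite andbT => /andP[_ k_lt]; have k_le : (k - n <= m)%N by lia.
apply: degree_in_leW (degree_inM (hc k) (degree_inX (hA _ k_le))) _.
by rewrite /=; lia.
Qed.

Lemma degree_in_aux_e m n N G : (0 < N)%N ->
  gen_bound V wa wb wA wB m n -> fam_bound V wa wb wA wB N G ->
  (degree_in V (aux_e m n G) <= N * (wa + wb + wB) + N.-1 * wA)%N.
Proof.
case: N => // N _ [ha hb hA hB] [halpha _ hc].
apply: degree_inD.
  apply: degree_in_leW (degree_inM (degree_inX (ha m (leqnn m))) halpha) _.
  by rewrite /=; lia.
rewrite big_nat_cond; apply: degree_inN; apply: degree_in_sum => k.
rewrite andbT => /andP[_ k_lt]; have k_le : (k - m <= n)%N by lia.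
apply: degree_in_leW (degree_inM (hc k) (degree_inX (hB _ k_le))) _.
by rewrite /=; lia.
Qed.

Lemma degree_in_step m n N1 N2 F G : (0 < N1)%N -> (0 < N2)%N ->
  gen_bound V wa wb wA wB m n ->
  fam_bound V wa wb wA wB N1 F -> fam_bound V wa wb wA wB N2 G ->
  fam_bound V wa wb wA wB (N1 + N2) (step m n F G).
Proof.
move=> N1_gt0 N2_gt0 hV hF hG.
have hd := degree_in_aux_d N1_gt0 hV hF.
have he := degree_in_aux_e N2_gt0 hV hG.
have [_ _ _ /(_ n (leqnn n)) hB] := hV.
have hBd := degree_inM (degree_inX hB) hd.
have [haF hbF hcF] := hF; have [haG hbG hcG] := hG.
case: N1 N1_gt0 {hF} hd hBd haF hbF hcF => // N1 _ hd hBd haF hbF hcF.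
case: N2 N2_gt0 {hG} he haG hbG hcG => // N2 _ he haG hbG hcG.
rewrite addSn addnS /=; split=> [||k] /=.
- apply: degree_inD; first by apply: degree_in_leW haF _ => /=; lia.
  by apply: degree_in_leW (degree_inM hBd haG) _ => /=; lia.
- apply: degree_inD; first by apply: degree_in_leW hbF _ => /=; lia.
  by apply: degree_in_leW (degree_inM hBd hbG) _ => /=; lia.
case: ifP => _.
  apply: degree_inD; first by apply: degree_in_leW (hcF k) _ => /=; lia.
  by apply: degree_in_leW (degree_inM hBd (hcG k)) _ => /=; lia.
case: ifP => _; last exact: degree_in0.
by apply: degree_in_leW (degree_inM hd he) _ => /=; lia.
Qed.

Lemma degree_in_fam m n : gen_bound V wa wb wA wB m n ->
  fam_bound V wa wb wA wB 'C(m + n, m) (fam m n).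
Proof.
elim: m n => [|m IHm] n; first by rewrite bin0; apply: degree_in_init0n.
elim: n => [|n IHn] hV; first by rewrite addn0 binn; apply: degree_in_initm0.
have -> : 'C(m.+1 + n.+1, m.+1) = ('C(m.+1 + n, m.+1) + 'C(m + n.+1, m))%N.
  by rewrite addnS binS addSnnS.
rewrite famSS; apply: degree_in_step => //; rewrite ?bin_gt0; try by lia.
- by apply: IHn; apply: gen_boundW hV.
- by apply: IHm; apply: gen_boundW hV.
Qed.

Lemma degree_in_member m n p : gen_bound V wa wb wA wB m n ->
  [\/ p = alpha m n, p = beta m n
     | exists2 k : nat, (k <= m + n)%N & p = c m n k] ->
  (degree_in V p <= 'C(m + n, m) * (wa + wb + wA + wB))%N.
Proof.
move=> /degree_in_fam; set N := 'C(_, _) => -[hal hbe hc].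
have leNw w : (N.-1 * w <= N * w)%N by rewrite leq_mul2r leq_pred orbT.
by case=> [->|->|[k _ ->]];
   [apply: degree_in_leW hal _|apply: degree_in_leW hbe _
   |apply: degree_in_leW (hc k) _];
   [have := leNw (wa + wA)%N|have := leNw (wb + wB)%N
   |have := leNw (wA + wB)%N]; lia.
Qed.

End Bounds.

Lemma in_SP m n p :
  in_S m n p <-> (degree_in (predC (vars m n)) p <= 0)%N.
Proof.
split=> [hp|/degree_in_leP hp u v /hp].
  apply/degree_in_leP => u up; rewrite leqn0 /mdeg_in big_seq_cond big1 //.
  move=> v /andP[_ /= vNmn]; apply/eqP; apply: contraNT vNmn.
  exact: hp.
rewrite leqn0 /mdeg_in sum_nat_seq_eq0 => /allP h uv.
have := h v; rewrite -cmE_neq0 uv /= (negbTE uv) implybF negbK.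
exact.
Qed.

Theorem proposition4 (m n : nat) (p : poly_ring)
  (hp : [\/ p = alpha m n, p = beta m n
          | exists2 k : nat, (k <= m + n)%N & p = c m n k]) :
  in_S m n p /\
  [/\ (degree_in (set_a m) p <= 'C(m + n, m))%N,
      (degree_in (set_b n) p <= 'C(m + n, m))%N,
      (degree_in (set_A m) p <= 'C(m + n, m))%N
    & (degree_in (set_B n) p <= 'C(m + n, m))%N].
Proof.
split.
  apply/in_SP; rewrite -(muln0 'C(m + n, m)).
  apply: (@degree_in_member _ 0 0 0 0) hp.
  by split=> i le_i; rewrite /= /vars /= le_i ?orbT.
rewrite -(muln1 'C(m + n, m)); split.
- by apply: (@degree_in_member _ 1 0 0 0) hp; split=> i //= _; apply: leq_b1.
- by apply: (@degree_in_member _ 0 1 0 0) hp; split=> i //= _; apply: leq_b1.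
- by apply: (@degree_in_member _ 0 0 1 0) hp; split=> i //= _; apply: leq_b1.
- by apply: (@degree_in_member _ 0 0 0 1) hp; split=> i //= _; apply: leq_b1.
Qed.
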